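(* Let $N\ge 2$, let $\lambda,\mu$ be parameters, and let $\psi(\xi;\nu)=\int_0^\xi\log(e^\eta+\nu)\,d\eta$. For $y,z\in\mathbb{R}^N$ define, in the periodic case (indices modulo $N$), $$\Lambda(y,z;\nu)=\sum_{k=1}^N\psi(z_k-y_k;-1)-\sum_{k=1}^N\psi(y_{k+1}-z_k;\nu),$$ and in the open-end case $$\Lambda(y,z;\nu)=\sum_{k=1}^N\psi(z_k-y_k;-1)-\sum_{k=1}^{N-1}\psi(y_{k+1}-z_k;\nu)+(z_N-y_1)\log\nu.$$ Let $x,\widetilde{x},\widehat{x},\widehat{\widetilde{x}}\in\mathbb{R}^N$ (with all logarithms defined) satisfy for all $k=1,\dots,N$ the corner equations $$(E)\ \big(e^{\widetilde{x}_k-x_k}-1\big)\big(\lambda+e^{x_k-\widetilde{x}_{k-1}}\big)=\big(e^{\widehat{x}_k-x_k}-1\big)\big(\mu+e^{x_k-\widehat{x}_{k-1}}\big),$$ $$(E_1)\ \big(e^{\widetilde{x}_k-x_k}-1\big)\big(\lambda+e^{x_{k+1}-\widetilde{x}_k}\big)=\big(e^{\widehat{\widetilde{x}}_k-\widetilde{x}_k}-1\big)\big(\mu+e^{\widetilde{x}_k-\widehat{\widetilde{x}}_{k-1}}\big),$$ $$(E_2)\ \big(e^{\widehat{x}_k-x_k}-1\big)\big(\mu+e^{x_{k+1}-\widehat{x}_k}\big)=\big(e^{\widehat{\widetilde{x}}_k-\widehat{x}_k}-1\big)\big(\lambda+e^{\widehat{x}_k-\widehat{\widetilde{x}}_{k-1}}\big),$$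 $$(E_{12})\ \big(e^{\widehat{\widetilde{x}}_k-\widehat{x}_k}-1\big)\big(\lambda+e^{\widehat{x}_{k+1}-\widehat{\widetilde{x}}_k}\big)=\big(e^{\widehat{\widetilde{x}}_k-\widetilde{x}_k}-1\big)\big(\mu+e^{\widetilde{x}_{k+1}-\widehat{\widetilde{x}}_k}\big),$$ where in the periodic case indices are modulo $N$, and in the open-end case every exponential whose exponent contains a field evaluated at index $0$ or $N+1$ is set equal to $0$. Then (in both cases) $$\Lambda(x,\widetilde{x};\lambda)+\Lambda(\widetilde{x},\widehat{\widetilde{x}};\mu)-\Lambda(x,\widehat{x};\mu)-\Lambda(\widehat{x},\widehat{\widetilde{x}};\lambda)=0,$$ i.e. the discrete multi-time Lagrangian 1-form is closed on any solution of the corner equations.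
   Context: $\Lambda(\cdot,\cdot;\nu)$ is the generating function ($p=-\partial\Lambda/\partial x$, $\widetilde p=\partial\Lambda/\partial\widetilde x$) of the Bäcklund transformation $F_\nu$ of the modified Toda lattice $\ddot x_k=\dot x_k(e^{x_{k+1}-x_k}-e^{x_k-x_{k-1}})$, given by $e^{p_k}=(e^{\widetilde x_k-x_k}-1)(\nu+e^{x_k-\widetilde x_{k-1}})$, $e^{\widetilde p_k}=(e^{\widetilde x_k-x_k}-1)(\nu+e^{x_{k+1}-\widetilde x_k})$. The open-end case corresponds formally to $x_0=+\infty$, $x_{N+1}=-\infty$ for all fields. *)

(* Defs.v *)
From HB Require Import structures.
From mathcomp Require Import all_boot all_order all_algebra.
From mathcomp Require Import all_classical all_reals all_analysis.
Set Implicit Arguments. Unset Strict Implicit. Unset Printing Implicit Defensive.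
Import Order.TTheory GRing.Theory Num.Theory.
Local Open Scope classical_set_scope.
Local Open Scope ring_scope.

(* psi(xi; nu) = \int_0^xi log(e^eta + nu) d eta  (oriented integral,
   Lebesgue integral; for nu = -1 the integrand has an integrable
   logarithmic singularity at 0). *)
Definition psi {R : realType} (xi nu : R) : R :=
  if 0 <= xi
  then Rintegral (@lebesgue_measure R) `[0, xi] (fun eta => ln (expR eta + nu))
  else - Rintegral (@lebesgue_measure R) `[xi, 0] (fun eta => ln (expR eta + nu)).

(* the logarithm in the integrand of psi(xi; nu) is defined (argument > 0)
   on the integration range between 0 and xi (the endpoint 0 excluded, where
   for nu = -1 the integrand is singular). *)
Definition psi_dom {R : realType} (xi nu : R) : Prop :=
  forall eta : R, (0 < eta <= xi) || (xi <= eta < 0) -> 0 < expR eta + nu.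

Inductive bc := Periodic | OpenEnd.

Definition wrap (N k : nat) : nat :=
  if k == 0%N then N else if k == N.+1 then 1%N else k.

(* fields are sequences x : nat -> R, only indices 1..N being meaningful *)

(* e^{f_i - g_j}: periodic indices mod N; in the open-end case it is 0 as soon
   as one of the indices is 0 or N+1 (x_0 = +oo, x_{N+1} = -oo). *)
Definition ex (c : bc) (N : nat) {R : realType}
    (f : nat -> R) (i : nat) (g : nat -> R) (j : nat) : R :=
  match c with
  | Periodic => expR (f (wrap N i) - g (wrap N j))
  | OpenEnd => if [&& (1 <= i <= N)%N & (1 <= j <= N)%N]
               then expR (f i - g j) else 0
  end.

Definition Lambda (c : bc) (N : nat) {R : realType}
    (y z : nat -> R) (nu : R) : R :=
  match c with
  | Periodic =>
      \sum_(1 <= k < N.+1) psi (z k - y k) (-1)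
      - \sum_(1 <= k < N.+1) psi (y (wrap N k.+1) - z k) nu
  | OpenEnd =>
      \sum_(1 <= k < N.+1) psi (z k - y k) (-1)
      - \sum_(1 <= k < N) psi (y k.+1 - z k) nu
      + (z N - y 1%N) * ln nu
  end.

Definition Lambda_dom (c : bc) (N : nat) {R : realType}
    (y z : nat -> R) (nu : R) : Prop :=
  match c with
  | Periodic =>
      forall k : nat, (1 <= k <= N)%N ->
        0 < z k - y k /\ psi_dom (y (wrap N k.+1) - z k) nu
  | OpenEnd =>
      0 < nu /\
      (forall k : nat, (1 <= k <= N)%N -> 0 < z k - y k) /\
      (forall k : nat, (1 <= k < N)%N -> psi_dom (y k.+1 - z k) nu)
  end.

Definition corner_eqs (c : bc) (N : nat) {R : realType} (lam mu : R)
    (x xt xh xht : nat -> R) (k : nat) : Prop :=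
  [/\ (expR (xt k - x k) - 1) * (lam + ex c N x k xt k.-1)
      = (expR (xh k - x k) - 1) * (mu + ex c N x k xh k.-1),
      (expR (xt k - x k) - 1) * (lam + ex c N x k.+1 xt k)
      = (expR (xht k - xt k) - 1) * (mu + ex c N xt k xht k.-1),
      (expR (xh k - x k) - 1) * (mu + ex c N x k.+1 xh k)
      = (expR (xht k - xh k) - 1) * (lam + ex c N xh k xht k.-1) &
      (expR (xht k - xh k) - 1) * (lam + ex c N xh k.+1 xht k)
      = (expR (xht k - xt k) - 1) * (mu + ex c N xt k.+1 xht k)].

(* Main.v *)
(* Write capitals for exponentials, X = X_{k+1}, T = Xt_k, H = Xh_k, Y = Xht_k,
   T' = Xt_{k+1}, H' = Xh_{k+1}. Equation (E) at k+1 and equation (E12) at k are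
   two relations between these six quantities, and by positivity they force
     lam + X/T = g (Y/T - 1),      mu + X/H = g (Y/H - 1),
     mu + T'/Y = g' (T'/X - 1),    lam + H'/Y = g' (H'/X - 1).
   (A priori the second relation of each row carries a factor r. If r <> 1, then
   q is the geometric mean both of g, r g' and of g', r g, whereas g - q and
   r g' - q have the same sign; so g = q = r g', likewise g' = q = r g, and r = 1.)
   Equation (E1) says that the g' of the bond (k, k+1) is the g of the bond
   (k+1, k+2). With q = X/Y, the terms of the closure sum attached to the bond
   are H(q, g) - H(q, g'), where H = G_lam - G_mu,
     G_nu(q, g) = psi(log((nu+g)/(g-q)); -1) - psi(log(q(nu+g)/(g-q)); nu),
     dG_nu/dg = log g (1/(g-q) - 1/(nu+g)).
   Hence dH/dg does not depend on q, the contribution of a bond is V(g) - V(g')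
   for an antiderivative V of dH/dg, and the closure sum telescopes. In the
   open-end case the boundary terms are the limit q = 0 of the same function.
   Negative parameters are allowed: then g < q also occurs, as does the
   degenerate case g = q = -lam = -mu, where G_nu is undefined. *)

Require Import Defs.
From HB Require Import structures.
From mathcomp Require Import all_boot all_order all_algebra.
From mathcomp Require Import all_classical all_reals all_analysis.
From mathcomp Require Import measurable_realfun zify ring lra.
Import Order.TTheory GRing.Theory Num.Theory.
Import numFieldNormedType.Exports.
Local Open Scope classical_set_scope.
Local Open Scope ring_scope.

(** * Oriented integrals *)

(** [psi xi nu] unfolds to a [prim] with base point 0. Other base points serve for [node]. *)
Definition prim {R : realType} (f : R -> R) (c x : R) : R :=
  if c <= x then Rintegral (@lebesgue_measure R) `[c, x] f
  else - Rintegral (@lebesgue_measure R) `[x, c] f.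

Lemma primE (R : realType) (f : R -> R) (l u c x : R) :
  (@lebesgue_measure R).-integrable `[l, u] (EFin \o f) ->
  l <= c <= u -> l <= x <= u ->
  prim f c x = Rintegral (@lebesgue_measure R) `[l, x] f
             - Rintegral (@lebesgue_measure R) `[l, c] f.
Proof.
move=> intf.
have sub a b : l <= a -> b <= u ->
    (@lebesgue_measure R).-integrable `[a, b] (EFin \o f).
  move=> la bu; apply: integrableS intf => // z /=.
  by rewrite !in_itv/= => /andP[/(le_trans la) -> /le_trans ->].
have main a b : l <= a -> a <= b -> b <= u ->
    Rintegral lebesgue_measure `[l, b] f - Rintegral lebesgue_measure `[l, a] f
    = Rintegral lebesgue_measure `[a, b] f.
  move=> la ab bu; rewrite Rintegral_itvB ?bnd_simp//; last exact: sub.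
  rewrite Rintegral_itv_obnd_cbnd//.
  by apply: integrableS (sub _ _ la bu) => //; apply: subset_itvr; rewrite bnd_simp.
move=> /andP[lc cu] /andP[lx xu]; rewrite /prim; case: leP => cx.
  by rewrite main.
by rewrite -main ?(ltW cx)// opprB.
Qed.

(** [primE] moves the base point to [l], which removes the case split on the order of [c] and [x].
    Continuity is asked at [x] only, so [c] may be a singular point of [f]. *)
Lemma is_derive_prim (R : realType) (f : R -> R) (l u c x : R) :
  (@lebesgue_measure R).-integrable `[l, u] (EFin \o f) ->
  l <= c <= u -> l < x < u -> {for x, continuous f} ->
  is_derive x (1 : R) (prim f c) (f x).
Proof.
move=> intf lcu /andP[lx xu] cf.
have [dF F'] := @continuous_FTC1 R f (BLeft l) x u xu intf lx cf.
apply: (@near_eq_is_derive _ _ _ ((fun y => Rintegral lebesgue_measure `[l, y] f)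
  - cst (Rintegral lebesgue_measure `[l, c] f))).
  near=> y; rewrite !fctE; apply/esym/(primE _ _ l u) => //.
  apply/andP; split; apply: ltW.
    by near: y; exact: lt_nbhsr.
  by near: y; exact: lt_nbhsl.
rewrite -[f x]subr0; apply: is_deriveB.
by rewrite -F' derive1E; exact: derivableP.
Unshelve. all: by end_near. Qed.

(** A dominating function for the logarithmic singularity of [psi] at parameter -1. Its
    antiderivative [F] is nonnegative, so the integrals over [[e, b]] are at most [F b] for every
    [e > 0], and monotone convergence lets [e] tend to 0. *)
Lemma integrable_2xBln (R : realType) (b : R) : 0 < b ->
  (@lebesgue_measure R).-integrable `]0, b]
    (EFin \o (fun x => x *+ 2 - ln x)).
Proof.
move=> b0.
pose f (x : R) := x *+ 2 - ln x.
pose F (x : R) := x * (x + 1 - ln x).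
have f0 (x : R) : 0 < x -> 0 <= f x.
  by move=> x0; have := ln_sublinear x0; rewrite /f; lra.
have F0 (x : R) : 0 < x -> 0 <= F x.
  move=> x0; rewrite /F mulr_ge0// ?(ltW x0)//.
  by have := ln_sublinear x0; lra.
have cf (x : R) : 0 < x -> {for x, continuous f}.
  move=> x0; apply: (@continuousB _ _ _ (fun x : R => x *+ 2) (@ln R)).
    by move=> ?; apply: cvgMn; exact: cvg_id.
  exact: continuous_ln.
have dF (x : R) : 0 < x -> is_derive x (1 : R) F (f x).
  move=> x0; have := is_derive1_ln x0 => dl.
  apply: is_derive_eq; rewrite /f !scaler1.
  rewrite /GRing.scale/=; field; exact: lt0r_neq0.
have mf : measurable_fun [set: R] f.
  apply: measurable_funB; last exact: measurable_ln.
  by under eq_fun do rewrite mulr2n; exact: measurable_funD.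
have piece (e : R) : 0 < e ->
    (\int[lebesgue_measure]_(x in `[e, b]) (f x)%:E <= (F b)%:E)%E.
  move=> e0; case: (ltP e b) => eb; last first.
    move: eb; rewrite le_eqVlt => /predU1P[->|be].
      by rewrite set_itv1 integral_set1 lee_fin F0.
    by rewrite set_itv_ge ?bnd_simp -?ltNge// integral_set0 lee_fin F0.
  rewrite (@continuous_FTC2 _ f F)//.
  - by rewrite -EFinB lee_fin gerBl F0.
  - apply/continuous_in_subspaceT => x; rewrite inE/= in_itv/= => /andP[ex _].
    by apply: cf; exact: lt_le_trans ex.
  - have cF (x : R) : 0 < x -> {for x, continuous F}.
      move=> x0; apply/differentiable_continuous/derivable1_diffP.
      by have [] := dF x x0.
    split.
    + move=> x; rewrite in_itv/= => /andP[ex _].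
      by have [] := dF x (lt_trans e0 ex).
    + exact/cvg_at_right_filter/cF.
    + exact/cvg_at_left_filter/cF.
  - move=> x; rewrite in_itv/= => /andP[ex _].
    by rewrite derive1E; have [_ ->] := dF x (lt_trans e0 ex).
apply/integrableP; split.
  by apply/measurable_EFinP; exact: measurable_funS mf.
apply: (@le_lt_trans _ _ (F b)%:E); last exact: ltry.
rewrite (_ : (\int[_]_(_ in _) _)%E =
   (\int[lebesgue_measure]_(x in `]0%R, b]) (f x)%:E)%E); last first.
  apply: eq_integral => x; rewrite inE/= in_itv/= => /andP[x0 _].
  by rewrite ger0_norm// f0.
rewrite itv_open_bnd_bigcup.
pose E n := `[(0 : R) + n.+1%:R^-1, b]%classic.
have ndE : nondecreasing_seq E.
  move=> n m nm; rewrite subsetEset => x; rewrite /E/= !in_itv/= => /andP[+ ->].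
  rewrite andbT; apply: le_trans; rewrite lerD2l.
  by rewrite lef_pV2 ?posrE ?ltr0n// ler_nat.
have mE n : measurable (E n) by exact: measurable_itv.
have mfE n : measurable_fun (E n) (EFin \o f).
  by apply/measurable_EFinP; exact: measurable_funS mf.
have fE0 n x : E n x -> (0 <= (EFin \o f) x)%E.
  rewrite /E/= in_itv/= add0r lee_fin => /andP[nx _].
  by apply/f0/(lt_le_trans _ nx); rewrite invr_gt0.
have cvgE : (\int[lebesgue_measure]_(x in E n) (EFin \o f) x)%E @[n --> \oo] -->
    (\int[lebesgue_measure]_(x in \bigcup_n E n) (EFin \o f) x)%E.
  exact: ge0_nondecreasing_set_cvg_integral.
rewrite -(cvg_lim _ cvgE)//; apply: lime_le; first by apply/cvg_ex; eexists; exact: cvgE.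
by apply: nearW => n; apply: piece; rewrite add0r invr_gt0.
Qed.

(** From [1 + x <= expR x] one gets [ln x <= ln (expR x - 1) <= x], hence the bound [x *+ 2 - ln x]
    for the absolute value; the endpoint 0 has measure zero. *)
Lemma integrable_ln_expRB1 (R : realType) (b : R) : 0 < b ->
  (@lebesgue_measure R).-integrable `[0, b]
    (EFin \o (fun x => ln (expR x - 1))).
Proof.
move=> b0.
have mf : measurable_fun [set: R] (fun x : R => ln (expR x - 1)).
  apply: measurableT_comp; first exact: measurable_ln.
  by apply: measurable_funB => //; exact: measurable_expR.
have iob : (@lebesgue_measure R).-integrable `]0, b]
    (EFin \o (fun x => ln (expR x - 1))).
  apply: le_integrable (integrable_2xBln R b b0) => //.
    by apply/measurable_EFinP; exact: measurable_funS mf.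
  move=> x /=; rewrite in_itv/= => /andP[x0 xb]; rewrite lee_fin.
  have ex : 1 + x <= expR x := expR_ge1Dx x.
  have e1 : 0 < expR x - 1 by lra.
  have l1 : ln x <= ln (expR x - 1) by rewrite ler_ln ?posrE//; lra.
  have l2 : ln (expR x - 1) <= x.
    by rewrite -[leRHS](expRK x) ler_ln ?posrE ?expR_gt0//; lra.
  have l3 := ln_sublinear x0.
  rewrite [leRHS]ger0_norm; last lra.
  by rewrite ler_norml; apply/andP; split; lra.
apply/integrableP; split.
  by apply/measurable_EFinP; exact: measurable_funS mf.
rewrite -integral_itv_obnd_cbnd.
  by have /integrableP[] := iob.
apply: measurableT_comp => //.
by apply/measurable_EFinP; exact: measurable_funS mf.
Qed.

(** * The star relations *)

Lemma mulr_sg_eq (R : realFieldType) (C B u v : R) : 0 < C -> 0 < B ->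
  C * u = B * v -> [/\ (0 < u) = (0 < v), (u < 0) = (v < 0) & (u == 0) = (v == 0)].
Proof.
move=> C0 B0 e; split.
- by rewrite -(pmulr_rgt0 _ C0) e pmulr_rgt0.
- by rewrite -(pmulr_rlt0 _ C0) e pmulr_rlt0.
- by rewrite -[LHS]orFb -{1}(gt_eqF C0) -mulf_eq0 e mulf_eq0 (gt_eqF B0).
Qed.

(* [q^2 = a b] puts [q] between [a] and [b]. *)
Lemma geometric_mean_eq (R : realFieldType) (a b q C B : R) :
  0 < a -> 0 < b -> 0 < q -> 0 < C -> 0 < B ->
  q ^+ 2 = a * b -> C * (a - q) = B * (b - q) -> a = q /\ b = q.
Proof.
move=> a0 b0 q0 C0 B0 qab e.
have [ep en ez] := mulr_sg_eq _ _ _ _ _ C0 B0 e.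
case: (ltrgtP (a - q) 0) => aq.
- have : b - q < 0 by rewrite -en.
  by move=> bq; nra.
- have : 0 < b - q by rewrite -ep.
  by move=> bq; nra.
- have : b - q == 0 by rewrite -ez aq.
  by move/eqP; lra.
Qed.

(** In the product of the two relations, divided by [B * D], the terms linear in [q] cancel, leaving
    [(r - 1) * (q ^+ 2 - r * (g * g')) = 0]. If the second factor vanishes, [geometric_mean_eq]
    applies to [g, r * g'] and to [g', r * g]. *)
Lemma star_ratio (R : realFieldType) (A B C D g g' r q : R) :
  0 < A -> 0 < B -> 0 < C -> 0 < D -> 0 < g -> 0 < g' -> 0 < q -> 0 < r ->
  B * D * r = A * C ->
  C * (g - q) = B * (r * g' - q) -> A * (g' - q) = D * (r * g - q) -> r = 1.
Proof.
move=> A0 B0 C0 D0 g0 g'0 q0 r0 er e1 e2.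
have : (r - 1) * (q ^+ 2 - r * (g * g')) = 0.
  have BD0 : B * D != 0 by rewrite mulf_neq0// gt_eqF.
  apply: (mulfI BD0); rewrite mulr0.
  have h : C * (g - q) * (A * (g' - q)) = B * (r * g' - q) * (D * (r * g - q)).
    by rewrite e1 e2.
  have -> : B * D * ((r - 1) * (q ^+ 2 - r * (g * g'))) =
     B * D * r * ((g - q) * (g' - q)) - B * (r * g' - q) * (D * (r * g - q)) by ring.
  by rewrite er -h; ring.
move=> /eqP; rewrite mulf_eq0 subr_eq0 => /orP[/eqP//|/eqP h].
have [gq gq'] : g = q /\ r * g' = q.
  by apply: (geometric_mean_eq _ _ _ _ C B); rewrite ?mulr_gt0//; lra.
have [hq hq'] : g' = q /\ r * g = q.
  by apply: (geometric_mean_eq _ _ _ _ A D); rewrite ?mulr_gt0//; lra.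
by apply: (mulIf (lt0r_neq0 q0)); rewrite mul1r -{1}gq.
Qed.

Lemma star_parameters (R : realFieldType) (lam mu T H Y X T' H' : R) :
  0 < T -> 0 < H -> 0 < Y -> 0 < X -> X < T' -> X < H' -> T < Y -> H < Y ->
  0 < lam + X / T -> 0 < mu + X / H -> 0 < mu + T' / Y -> 0 < lam + H' / Y ->
  (T' / X - 1) * (lam + X / T) = (H' / X - 1) * (mu + X / H) ->
  (Y / H - 1) * (lam + H' / Y) = (Y / T - 1) * (mu + T' / Y) ->
  let q := X / Y in
  let g := (lam + X / T) / (Y / T - 1) in
  let g' := (mu + T' / Y) / (T' / X - 1) in
  [/\ 0 < g, 0 < g' & 0 < q] /\
  [/\ lam + q = (Y / T - 1) * (g - q), mu + q = (Y / H - 1) * (g - q),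
      lam + q = (H' / X - 1) * (g' - q) & mu + q = (T' / X - 1) * (g' - q)].
Proof.
move=> T0 H0 Y0 X0 XT' XH' TY HY al0 be0 ga0 de0 E E12 q g g'.
have gt1 (u v : R) : 0 < u -> u < v -> 0 < v / u - 1.
  by move=> u0 uv; rewrite subr_gt0 ltr_pdivlMr// mul1r.
set A := T' / X - 1 in E E12 g' *; set B := H' / X - 1 in E E12 *.
set C := Y / T - 1 in E E12 g *; set D := Y / H - 1 in E E12 *.
have A0 : 0 < A by exact: gt1.
have B0 : 0 < B by exact: gt1.
have C0 : 0 < C by exact: gt1.
have D0 : 0 < D by exact: gt1.
have [An0 Bn0 Cn0 Dn0] : [/\ A != 0, B != 0, C != 0 & D != 0].
  by split; exact: lt0r_neq0.
have g0 : 0 < g by exact: divr_gt0.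
have g'0 : 0 < g' by exact: divr_gt0.
have q0 : 0 < q by exact: divr_gt0.
have [Tn Hn Yn Xn] : [/\ T != 0, H != 0, Y != 0 & X != 0].
  by split; exact: lt0r_neq0.
(* Chosen so that (E) reads [mu + X / H = r * g * D] and (E12) reads [lam + H' / Y = r * g' * B]. *)
pose r := A * C / (B * D).
have r0 : 0 < r by rewrite divr_gt0 ?mulr_gt0.
have er : B * D * r = A * C by rewrite /r; field; rewrite Bn0 Dn0.
have eal : lam + X / T = g * C by rewrite /g divfK.
have ega : mu + T' / Y = g' * A by rewrite /g' divfK.
have ebe : mu + X / H = r * g * D.
  apply: (mulfI Bn0); rewrite -E eal.
  by rewrite (_ : B * (r * g * D) = B * D * r * g); [rewrite er; ring|ring].
have ede : lam + H' / Y = r * g' * B.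
  apply: (mulfI Dn0); rewrite E12 ega.
  by rewrite (_ : D * (r * g' * B) = B * D * r * g'); [rewrite er; ring|ring].
(* Since [X / T = q * (C + 1)], and likewise for the other three quotients, adding [q] turns each
   relation into a product. *)
have lC : lam + q = C * (g - q).
  have -> : lam = g * C - X / T by rewrite -eal; ring.
  by rewrite /q /C; field; rewrite Tn Yn.
have lB : lam + q = B * (r * g' - q).
  have -> : lam = r * g' * B - H' / Y by rewrite -ede; ring.
  by rewrite /q /B; field; rewrite Xn Yn.
have mA : mu + q = A * (g' - q).
  have -> : mu = g' * A - T' / Y by rewrite -ega; ring.
  by rewrite /q /A; field; rewrite Xn Yn.
have mD : mu + q = D * (r * g - q).
  have -> : mu = r * g * D - X / H by rewrite -ebe; ring.
  by rewrite /q /D; field; rewrite Hn Yn.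
have r1 : r = 1.
  by apply: (star_ratio _ A B C D g g' r q) => //; rewrite -?lC -?mA.
by rewrite r1 !mul1r in lB mD.
Qed.

(** * The function psi and the edge functions *)

Lemma is_derive_prim_continuous (R : realType) (f : R -> R) (a b c x : R) :
  (forall y, a < y < b -> {for y, continuous f}) ->
  a < c < b -> a < x < b -> is_derive x (1 : R) (prim f c) (f x).
Proof.
move=> cf /andP[ac cb] /andP[ax xb].
(* A compact segment inside the open interval, with [c] in it and [x] in its interior. *)
pose l := (a + Num.min c x) / 2; pose u := (Num.max c x + b) / 2.
have am : a < Num.min c x by rewrite lt_min ac.
have Mb : Num.max c x < b by rewrite gt_max cb.
have [mc mx] : Num.min c x <= c /\ Num.min c x <= x by rewrite !ge_min !lexx orbT.
have [cM xM] : c <= Num.max c x /\ x <= Num.max c x by rewrite !le_max !lexx orbT.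
have al : a < l by rewrite /l; lra.
have lm : l < Num.min c x by rewrite /l; lra.
have Mu : Num.max c x < u by rewrite /u; lra.
have ub : u < b by rewrite /u; lra.
apply: (is_derive_prim _ _ l u).
- apply: continuous_compact_integrable; first exact: segment_compact.
  apply/continuous_in_subspaceT => y; rewrite inE/= in_itv/= => /andP[ly yu].
  by apply: cf; rewrite (lt_le_trans al)//= (le_lt_trans yu).
- by apply/andP; split; lra.
- by apply/andP; split; lra.
- by apply: cf; rewrite ax.
Qed.

Lemma continuous_ln_expRD (R : realType) (nu x : R) : 0 < expR x + nu ->
  {for x, continuous (fun y => ln (expR y + nu))}.
Proof.
move=> h; apply: continuous_comp; last exact: continuous_ln.
by apply: continuousD; [exact: continuous_expR|exact: cst_continuous].
Qed.

(** With [-1 < nu] the base point 0 lies where the integrand is continuous: beyond [ln (- nu) < 0]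
    if [nu < 0], on the whole line otherwise. *)
Lemma is_derive_psi (R : realType) (nu x : R) : -1 < nu -> 0 < expR x + nu ->
  is_derive x (1 : R) (fun y => psi y nu) (ln (expR x + nu)).
Proof.
move=> nu1 xnu.
have [nu0|nu0] := ltP nu 0.
  have nuE : expR (ln (- nu)) = - nu by rewrite lnK// posrE oppr_gt0.
  apply: (is_derive_prim_continuous _ (fun y => ln (expR y + nu))
    (ln (- nu)) (Num.max 0 x + 1) 0 x).
  - move=> y /andP[ly _]; apply: continuous_ln_expRD.
    by rewrite -ltr_expR nuE in ly; lra.
  - rewrite -ltr_expR nuE expR0; apply/andP; split; first lra.
    have : 0 <= Num.max 0 x by rewrite le_max lexx.
    by lra.
  - rewrite -ltr_expR nuE; apply/andP; split; first lra.
    have : x <= Num.max 0 x by rewrite le_max lexx orbT.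
    by lra.
have [m0 mx] : Num.min 0 x <= 0 /\ Num.min 0 x <= x by rewrite !ge_min !lexx orbT.
have [M0 xM] : 0 <= Num.max 0 x /\ x <= Num.max 0 x by rewrite !le_max !lexx orbT.
apply: (is_derive_prim_continuous _ (fun y => ln (expR y + nu))
    (Num.min 0 x - 1) (Num.max 0 x + 1) 0 x).
- move=> y _; apply: continuous_ln_expRD.
  by have := expR_gt0 y; lra.
- by apply/andP; split; lra.
- by apply/andP; split; lra.
Qed.

Lemma is_derive_psiN1 (R : realType) (x : R) : 0 < x ->
  is_derive x (1 : R) (fun y => psi y (-1)) (ln (expR x - 1)).
Proof.
move=> x0.
apply: (is_derive_prim _ (fun y => ln (expR y - 1)) 0 (x + 1)).
- by apply: integrable_ln_expRB1; lra.
- by apply/andP; split; lra.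
- by apply/andP; split; lra.
- by apply: continuous_ln_expRD; rewrite subr_gt0 expR_gt1.
Qed.

(** The mean value theorem for [F - G]. The predicate [P] stands for an interval of any shape, given
    by its convexity. *)
Lemma is_derive_eq_diff (R : realType) (F G h : R -> R) (P : R -> Prop) (a b : R) :
  P a -> P b ->
  (forall u v x, P u -> P v -> u <= x <= v -> P x) ->
  (forall x, P x -> is_derive x (1 : R) F (h x)) ->
  (forall x, P x -> is_derive x (1 : R) G (h x)) ->
  F a - F b = G a - G b.
Proof.
move=> + + itvP dF dG; wlog ab : a b / a <= b.
  move=> H Pa Pb; case: (leP a b) => [ab|/ltW ba]; first exact: H.
  by have := H _ _ ba Pb Pa; lra.
move=> Pa Pb.
have dH x : P x -> is_derive x (1 : R) (F - G) 0.
  by move=> Px; rewrite -(subrr (h x)); apply: is_deriveB; [exact: dF|exact: dG].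
have [||c _] := @MVT_segment R (F - G) (cst 0) a b ab.
- move=> x; rewrite in_itv/= => /andP[/ltW ax /ltW xb]; apply: dH.
  by apply: (itvP a b) => //; rewrite ax.
- apply: derivable_within_continuous => x; rewrite in_itv/= => xab.
  by have [] := dH x (itvP a b x Pa Pb xab).
by rewrite /= mul0r !fctE; lra.
Qed.

(** * Edge functions and their common antiderivative *)

Lemma is_derive_ln_frac (R : realType) (nu q g : R) : 0 < (nu + g) / (g - q) ->
  is_derive g (1 : R) (fun s => ln ((nu + s) / (s - q))) ((nu + g)^-1 - (g - q)^-1).
Proof.
move=> h.
have : (nu + g) / (g - q) != 0 by exact: lt0r_neq0.
rewrite mulf_eq0 invr_eq0 negb_or => /andP[n1 n2].
have d1 : is_derive g (1 : R) (fun s => (nu + s) / (s - q))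
    (- (nu + q) / (g - q) ^+ 2).
  have dB : is_derive g (1 : R) (fun s : R => s - q) 1.
    by apply: is_derive_eq; rewrite subr0.
  have dV := @is_deriveV _ (fun s : R => s - q) _ _ _ n2 dB.
  apply: is_derive_eq; rewrite /GRing.scale/=; field; exact: n2.
have d2 := is_derive1_ln h.
apply: (is_derive_eq
  (@is_derive1_comp _ (@ln R) (fun s => (nu + s) / (s - q)) _ _ _ d2 d1)).
by field; rewrite n1 n2.
Qed.

(** The function [G_nu(q, g)]. The logarithm of the product is kept as a sum because in a bond
    [ln q] is the difference [x' - y] of fields. *)
Definition edge {R : realType} (nu q g : R) : R :=
  psi (ln ((nu + g) / (g - q))) (-1) - psi (ln q + ln ((nu + g) / (g - q))) nu.

Lemma same_sg_frac (R : realFieldType) (nu q g : R) : 0 < (nu + q) / (g - q) ->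
  0 < (nu + g) / (g - q) /\ (nu + g) / (g - q) - 1 = (nu + q) / (g - q).
Proof.
move=> h; have : (nu + q) / (g - q) != 0 by exact: lt0r_neq0.
rewrite mulf_eq0 invr_eq0 negb_or => /andP[_ n].
have e : (nu + g) / (g - q) - 1 = (nu + q) / (g - q) by field; exact: n.
by split => //; lra.
Qed.

(** Both terms contain the derivative of the same [p], and
    [expR (ln q + p) + nu = g * (expR p - 1)]; so the two integrands differ by [ln g] alone. *)
Lemma is_derive_edge (R : realType) (nu q g : R) : -1 < nu -> 0 < q -> 0 < g ->
  0 < (nu + q) / (g - q) ->
  is_derive g (1 : R) (edge nu q) (ln g * ((g - q)^-1 - (nu + g)^-1)).
Proof.
move=> nu1 q0 g0 h; have [h0 e] := same_sg_frac _ _ _ _ h.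
have : (nu + g) / (g - q) != 0 by exact: lt0r_neq0.
rewrite mulf_eq0 invr_eq0 negb_or => /andP[n1 n2].
set p := ln ((nu + g) / (g - q)).
have ep : expR p = (nu + g) / (g - q) by rewrite lnK.
have p0 : 0 < p by rewrite -expR_gt1 ep; lra.
have eqp : expR (ln q + p) + nu = g * ((nu + q) / (g - q)).
  by rewrite expRD ep lnK// ; field; exact: n2.
have dp := is_derive_ln_frac _ _ _ _ h0.
have d1 := is_derive_psiN1 _ _ p0.
have d2 : is_derive (ln q + p) (1 : R) (fun y => psi y nu) (ln (expR (ln q + p) + nu)).
  by apply: is_derive_psi => //; rewrite eqp mulr_gt0.
have dqp : is_derive g (1 : R) (fun s => ln q + ln ((nu + s) / (s - q)))
    ((nu + g)^-1 - (g - q)^-1).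
  by rewrite -[X in is_derive _ _ _ X]add0r; apply: is_deriveD.
apply: (is_derive_eq (is_deriveB
  (@is_derive1_comp _ (fun y => psi y (-1))
     (fun s => ln ((nu + s) / (s - q))) _ _ _ d1 dp)
  (@is_derive1_comp _ (fun y => psi y nu)
     (fun s => ln q + ln ((nu + s) / (s - q))) _ _ _ d2 dqp))).
rewrite eqp ep e lnM// ?posrE//; ring.
Qed.

(** The derivative of [edge lam q - edge mu q]: the terms [(g - q)^-1] cancel, and with them all
    dependence on [q]. *)
Definition edge_density {R : realType} (lam mu s : R) : R :=
  ln s * ((mu + s)^-1 - (lam + s)^-1).

Lemma continuous_edge_density (R : realType) (lam mu s : R) :
  0 < s -> lam + s != 0 -> mu + s != 0 ->
  {for s, continuous (edge_density lam mu)}.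
Proof.
move=> s0 ls ms.
have cV (nu : R) : nu + s != 0 -> {for s, continuous (fun s => (nu + s)^-1)}.
  move=> n; apply: continuousV => //.
  by apply: continuousD; [exact: cst_continuous|exact: cvg_id].
apply: continuousM; first exact: continuous_ln.
by apply: continuousB; exact: cV.
Qed.

(** The antiderivative V. The base point must lie in the same admissible interval as [g]: for
    [-1 < lam] and [-1 < mu], 1 is in the upper one, and the lower one, []0, min(-lam, -mu)[], is
    represented by its midpoint. *)
Definition node {R : realType} (lam mu g : R) : R :=
  prim (edge_density lam mu) (if 0 < lam + g then 1 else Num.min (- lam) (- mu) / 2) g.

(* The admissible [g] for given [lam], [mu] form two intervals. *)
Definition node_dom {R : realType} (lam mu : R) (b : bool) (g : R) : Prop :=
  0 < g /\ if b then 0 < lam + g /\ 0 < mu + g else lam + g < 0 /\ mu + g < 0.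

Lemma is_derive_node_prim (R : realType) (lam mu : R) b (g : R) :
  -1 < lam -> -1 < mu -> node_dom lam mu b g ->
  is_derive g (1 : R)
    (prim (edge_density lam mu) (if b then 1 else Num.min (- lam) (- mu) / 2))
    (edge_density lam mu g).
Proof.
move=> l1 m1; rewrite /node_dom; case: b => -[g0 [lg mg]].
  apply: (is_derive_prim_continuous _ _ (Num.max 0 (Num.max (- lam) (- mu)))
    (Num.max 1 g + 1)).
  - move=> y /andP[]; rewrite !gt_max => /and3P[y0 ly my] _.
    by apply: continuous_edge_density => //; apply: lt0r_neq0; lra.
  - rewrite !gt_max ltr_pwDr// ?le_max ?lexx// andbT.
    by apply/and3P; split; lra.
  - rewrite !gt_max ltr_pwDr// ?le_max ?lexx ?orbT// andbT.
    by apply/and3P; split; lra.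
have m0 : 0 < Num.min (- lam) (- mu) by rewrite lt_min; apply/andP; split; lra.
apply: (is_derive_prim_continuous _ _ 0 (Num.min (- lam) (- mu))).
- move=> y /andP[y0]; rewrite lt_min => /andP[ly my].
  by apply: continuous_edge_density => //; apply: ltr0_neq0; lra.
- by apply/andP; split; lra.
- by rewrite lt_min; apply/and3P; split; lra.
Qed.

Lemma nodeE (R : realType) (lam mu : R) b (g : R) : node_dom lam mu b g ->
  node lam mu g =
  prim (edge_density lam mu) (if b then 1 else Num.min (- lam) (- mu) / 2) g.
Proof.
rewrite /node /node_dom; case: b => -[_ [h _]]; first by rewrite h.
by rewrite ltNge (ltW h).
Qed.

(** The boolean [b] records the common sign of [lam + q], [mu + q] and [g - q]; on that side of [q]
    both differences have derivative [edge_density lam mu]. *)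
Lemma edge_diff (R : realType) (lam mu q g g' : R) b :
  -1 < lam -> -1 < mu -> 0 < q -> node_dom lam mu b q ->
  (if b then q < g else g < q) -> (if b then q < g' else g' < q) ->
  0 < g -> 0 < g' ->
  (edge lam q g - edge mu q g) - (edge lam q g' - edge mu q g')
  = node lam mu g - node lam mu g'.
Proof.
move=> l1 m1 q0 [_ qb] gb gb' g0 g'0.
pose P (c : bool) (s : R) := 0 < s /\ if c then q < s else s < q.
have PD s : P b s -> node_dom lam mu b s.
  by rewrite /P /node_dom; case: b qb {gb gb'} => -[? ?] [? ?]; repeat split; lra.
have Pg : P b g by split.
have Pg' : P b g' by split.
rewrite !(nodeE _ _ _ b); [|exact: PD..].
apply: (is_derive_eq_diff _ (fun s => edge lam q s - edge mu q s) _
    (edge_density lam mu) (P b)) => //.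
- by rewrite /P; case: b {qb gb gb' PD Pg Pg'} => u v x [? ?] [? ?] /andP[? ?]; split; lra.
- move=> s Ps; have [s0 _] := Ps.
  have h (nu : R) : (if b then 0 < nu + q else nu + q < 0) -> 0 < (nu + q) / (s - q).
    case: b Ps {qb gb gb' PD Pg Pg'} => -[_ sq] nuq.
      by apply: divr_gt0; lra.
    by rewrite nmulr_rgt0// invr_lt0; lra.
  have [lq mq] : (if b then 0 < lam + q else lam + q < 0) /\
                 (if b then 0 < mu + q else mu + q < 0) by case: b qb {gb gb' PD Pg Pg' Ps h}.
  apply: (is_derive_eq (is_deriveB (is_derive_edge _ _ _ _ l1 q0 s0 (h _ lq))
                                   (is_derive_edge _ _ _ _ m1 q0 s0 (h _ mq)))).
  by rewrite /edge_density; ring.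
- by move=> s /PD; exact: is_derive_node_prim.
Qed.

Lemma edgeE (R : realType) (nu q g a : R) : g != q ->
  nu + q = (expR a - 1) * (g - q) -> edge nu q g = psi a (-1) - psi (ln q + a) nu.
Proof.
rewrite -subr_eq0 => n e; rewrite /edge (_ : (nu + g) / (g - q) = expR a) ?expRK//.
have -> : nu + g = (nu + q) + (g - q) by ring.
by rewrite e; field; exact: n.
Qed.

(* As functions of [g], [edge0] is the limit of [edge] at [q = 0] up to an
   additive constant. *)
Definition edge0 {R : realType} (nu g : R) : R :=
  psi (ln ((nu + g) / g)) (-1) - ln nu * ln ((nu + g) / g).

Lemma edge0E (R : realType) (nu g a : R) : g != 0 ->
  nu = (expR a - 1) * g -> edge0 nu g = psi a (-1) - ln nu * a.
Proof.
move=> n e; rewrite /edge0 (_ : (nu + g) / g = expR a) ?expRK//.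
by rewrite e; field.
Qed.

(** For [p = ln ((nu + g) / g)] one has [expR p - 1 = nu / g], and the subtracted term cancels the
    contribution of [ln nu]. *)
Lemma is_derive_edge0 (R : realType) (nu g : R) : 0 < nu -> 0 < g ->
  is_derive g (1 : R) (edge0 nu) (ln g * (g^-1 - (nu + g)^-1)).
Proof.
move=> nu0 g0.
have ng : nu + g != 0 by apply: lt0r_neq0; lra.
have gn : g != 0 by exact: lt0r_neq0.
have h0 : 0 < (nu + g) / (g - 0) by rewrite subr0 divr_gt0//; lra.
have dp : is_derive g (1 : R) (fun s => ln ((nu + s) / s)) ((nu + g)^-1 - g^-1).
  have := is_derive_ln_frac _ _ _ _ h0; rewrite subr0.
  by under eq_fun do rewrite subr0.
rewrite subr0 in h0.
have ep : expR (ln ((nu + g) / g)) - 1 = nu / g.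
  by rewrite lnK//; field; exact: gn.
have p0 : 0 < ln ((nu + g) / g).
  by rewrite -expR_gt1; have : 0 < nu / g := divr_gt0 nu0 g0; rewrite -ep; lra.
have dq : is_derive g (1 : R) (fun s => ln nu * ln ((nu + s) / s))
    (ln nu * ((nu + g)^-1 - g^-1)).
  by apply: is_derive_eq.
apply: (is_derive_eq (is_deriveB (@is_derive1_comp _ (fun y => psi y (-1))
  (fun s => ln ((nu + s) / s)) _ _ _ (is_derive_psiN1 _ _ p0) dp) dq)).
by rewrite ep ln_div ?posrE//; ring.
Qed.

Lemma edge0_diff (R : realType) (lam mu g g' : R) :
  0 < lam -> 0 < mu -> 0 < g -> 0 < g' ->
  (edge0 lam g - edge0 mu g) - (edge0 lam g' - edge0 mu g')
  = node lam mu g - node lam mu g'.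
Proof.
move=> l0 m0 g0 g'0.
have D (s : R) : 0 < s -> node_dom lam mu true s.
  by move=> s0; rewrite /node_dom; repeat split; lra.
rewrite !(nodeE _ _ _ true); [|exact: D..].
apply: (is_derive_eq_diff _ (fun s => edge0 lam s - edge0 mu s) _
    (edge_density lam mu) (fun s => 0 < s)) => //.
- by move=> u v x u0 _ /andP[+ _]; exact: lt_le_trans.
- move=> s s0.
  apply: (is_derive_eq (is_deriveB (is_derive_edge0 _ _ _ l0 s0)
                                   (is_derive_edge0 _ _ _ m0 s0))).
  by rewrite /edge_density; ring.
- by move=> s s0; apply: (is_derive_node_prim _ _ _ true); [lra|lra|exact: D].
Qed.

(** The degenerate case [nu = - q]: there [expR (ln q + s) - q = q * (expR s - 1)], so the
    expression has zero derivative in [s]. *)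
Lemma psi_shift_diff (R : realType) (q a b : R) : 0 < q -> q < 1 -> 0 < a -> 0 < b ->
  psi a (-1) - psi (ln q + a) (- q) + ln q * a =
  psi b (-1) - psi (ln q + b) (- q) + ln q * b.
Proof.
move=> q0 q1 a0 b0.
pose F (s : R) := psi s (-1) - psi (ln q + s) (- q) + ln q * s.
suff : F a - F b = 0 - 0 by rewrite /F; lra.
apply: (is_derive_eq_diff _ F (cst 0) (cst 0) (fun s => 0 < s)) => //.
- by move=> u v x u0 _ /andP[+ _]; exact: lt_le_trans.
- move=> s s0.
  have es : 0 < expR s - 1 by rewrite subr_gt0 expR_gt1.
  have eqs : expR (ln q + s) - q = q * (expR s - 1).
    by rewrite expRD lnK//; ring.
  have d2 : is_derive (ln q + s) (1 : R) (fun y => psi y (- q))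
      (ln (expR (ln q + s) - q)).
    by apply: is_derive_psi; [lra|rewrite eqs mulr_gt0].
  have ds : is_derive s (1 : R) (fun s => ln q + s) 1.
    by rewrite -[X in is_derive _ _ _ X]add0r; apply: is_deriveD.
  have dl : is_derive s (1 : R) (fun s => ln q * s) (ln q).
    by apply: is_derive_eq; rewrite /GRing.scale/= mulr1.
  apply: (is_derive_eq (is_deriveD (is_deriveB (is_derive_psiN1 _ _ s0)
    (@is_derive1_comp _ (fun y => psi y (- q)) (fun s => ln q + s) _ _ _ d2 ds)) dl)).
  by rewrite eqs lnM ?posrE//=; ring.
Qed.

(* When [lam = mu = - g] the two branches of one multivalued transformation meet,
   and [g] no longer determines [xt - xh]. *)
Definition potential {R : realType} (lam mu xt xh g : R) : R :=
  if lam + g == 0 then ln g * (xt - xh) else node lam mu g.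

(** The eight terms attached to the bond [(k, k+1)]: [xt], [xh] and [y = xht] are taken at [k], the
    primed fields at [k+1]. *)
Lemma bond_closure (R : realType) (lam mu xt xh y x' xt' xh' : R) :
  -1 < lam -> -1 < mu -> 0 < xt' - x' -> 0 < xh' - x' -> 0 < y - xt -> 0 < y - xh ->
  0 < lam + expR (x' - xt) -> 0 < mu + expR (x' - xh) ->
  0 < mu + expR (xt' - y) -> 0 < lam + expR (xh' - y) ->
  (expR (xt' - x') - 1) * (lam + expR (x' - xt))
    = (expR (xh' - x') - 1) * (mu + expR (x' - xh)) ->
  (expR (y - xh) - 1) * (lam + expR (xh' - y))
    = (expR (y - xt) - 1) * (mu + expR (xt' - y)) ->
  psi (xt' - x') (-1) + psi (y - xt) (-1) - psi (xh' - x') (-1) - psi (y - xh) (-1)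
  - psi (x' - xt) lam - psi (xt' - y) mu + psi (x' - xh) mu + psi (xh' - y) lam
  = potential lam mu xt xh ((lam + expR (x' - xt)) / (expR (y - xt) - 1))
    - potential lam mu xt' xh' ((mu + expR (xt' - y)) / (expR (xt' - x') - 1)).
Proof.
move=> l1 m1; rewrite !subr_gt0 -[x' < xt']ltr_expR -[x' < xh']ltr_expR.
rewrite -[xt < y]ltr_expR -[xh < y]ltr_expR => pA pB pC pD pal pbe pga pde E E12.
have eqq : ln (expR x' / expR y) = x' - y by rewrite -expRB expRK.
move: (pal) (pbe) (pga) (pde) (E) (E12).
rewrite [expR (x' - xt)]expRB [expR (x' - xh)]expRB [expR (xt' - y)]expRB.
rewrite [expR (xh' - y)]expRB [expR (xt' - x')]expRB [expR (xh' - x')]expRB.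
rewrite [expR (y - xt)]expRB [expR (y - xh)]expRB => pal' pbe' pga' pde' E' E12'.
have := star_parameters _ _ _ _ _ _ _ _ _ (expR_gt0 _) (expR_gt0 _) (expR_gt0 _)
  (expR_gt0 _) pA pB pC pD pal' pbe' pga' pde' E' E12'.
set q := expR x' / expR y in eqq *.
set g := (lam + _) / _; set g' := (mu + expR xt' / _) / _.
move=> [[g0 g'0 q0] [eC eD eB eA]].
have B0 : 0 < expR xh' / expR x' - 1 by rewrite -expRB subr_gt0 expR_gt1 subr_gt0 -ltr_expR.
have C0 : 0 < expR y / expR xt - 1 by rewrite -expRB subr_gt0 expR_gt1 subr_gt0 -ltr_expR.
(* Both products equal [lam + q], so [g - q] and [g' - q] have the same sign. *)
have [pB' nB' zB] := mulr_sg_eq _ _ _ _ _ B0 C0 (etrans (esym eB) eC).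
have -> : xt' - y = ln q + (xt' - x') by rewrite eqq; ring.
have -> : xh' - y = ln q + (xh' - x') by rewrite eqq; ring.
have -> : x' - xt = ln q + (y - xt) by rewrite eqq; ring.
have -> : x' - xh = ln q + (y - xh) by rewrite eqq; ring.
rewrite -!expRB in eA eB eC eD.
clear pal pbe pga pde E E12 pal' pbe' pga' pde' E' E12' B0 C0.
(* Equality forces [lam = mu = - q] and [g' = q]; two uses of [psi_shift_diff] then leave only
   multiples of [ln q]. *)
have [gq|gq] := eqVneq g q.
  have lq : lam = - q by apply/eqP; rewrite -addr_eq0 eC gq subrr mulr0.
  have mq : mu = - q by apply/eqP; rewrite -addr_eq0 eD gq subrr mulr0.
  have g'q : g' = q.
    by apply/eqP; rewrite -subr_eq0 zB gq subrr.
  rewrite /potential gq g'q lq mq addNr eqxx.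
  have q1 : q < 1 by rewrite -ltrN2 -lq.
  have pos (u v : R) : expR u < expR v -> 0 < v - u.
    by rewrite subr_gt0 ltr_expR.
  move: (psi_shift_diff _ _ _ _ q0 q1 (pos _ _ pA) (pos _ _ pB)).
  move: (psi_shift_diff _ _ _ _ q0 q1 (pos _ _ pC) (pos _ _ pD)).
  clear; lra.
have g'q : g' != q by rewrite -subr_eq0 zB subr_eq0.
have C0 : 0 < expR (y - xt) - 1 by rewrite subr_gt0 expR_gt1 subr_gt0 -ltr_expR.
have D0 : 0 < expR (y - xh) - 1 by rewrite subr_gt0 expR_gt1 subr_gt0 -ltr_expR.
have pC' : (0 < lam + q) = (0 < g - q) by rewrite eC pmulr_rgt0.
have nC' : (lam + q < 0) = (g - q < 0) by rewrite eC pmulr_rlt0.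
have pD' : (0 < mu + q) = (0 < g - q) by rewrite eD pmulr_rgt0.
have nD' : (mu + q < 0) = (g - q < 0) by rewrite eD pmulr_rlt0.
(* It is the sum of [lam + q] and [g - q], which have the same nonzero sign. *)
have lg0 : lam + g != 0.
  case: (ltrgtP (g - q) 0) => c; [rewrite c in nC'|rewrite c in pC'|].
  - by apply: ltr0_neq0; lra.
  - by apply: lt0r_neq0; lra.
  - by move/eqP: c; rewrite subr_eq0 (negbTE gq).
have lg'0 : lam + g' != 0.
  case: (ltrgtP (g - q) 0) => c; [rewrite c in nC' nB'|rewrite c in pC' pB'|].
  - by apply: ltr0_neq0; lra.
  - by apply: lt0r_neq0; lra.
  - by move/eqP: c; rewrite subr_eq0 (negbTE gq).
rewrite /potential (negbTE lg0) (negbTE lg'0).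
have D : node_dom lam mu (q < g) q.
  rewrite /node_dom; split=> //; case: ltrgtP gq => // c _.
    by rewrite pC' pD' subr_gt0.
  by rewrite nC' nD' subr_lt0.
have s : if q < g then q < g else g < q by case: ltrgtP gq.
have s' : if q < g then q < g' else g' < q.
  case: ltrgtP gq => // c _.
    by rewrite -subr_gt0 pB' subr_gt0.
  by rewrite -subr_lt0 nB' subr_lt0.
rewrite -(edge_diff _ _ _ q g g' (q < g))//.
rewrite (edgeE _ lam q g (y - xt))// (edgeE _ mu q g (y - xh))//.
rewrite (edgeE _ lam q g' (xh' - x'))// (edgeE _ mu q g' (xt' - x'))//.
ring.
Qed.

(** * Summation over the chain *)

Lemma wrap_id (N k : nat) : (1 <= k <= N)%N -> Defs.wrap N k = k.
Proof. by rewrite /Defs.wrap => ?; case: eqP => [|_]; [lia|case: eqP => //; lia]. Qed.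

Lemma wrap_range (N k : nat) : (1 <= k <= N)%N -> (1 <= Defs.wrap N k.+1 <= N)%N.
Proof. by rewrite /Defs.wrap /= => ?; case: eqP; lia. Qed.

Lemma wrap_pred_succ (N k : nat) : (1 <= k <= N)%N -> Defs.wrap N (Defs.wrap N k.+1).-1 = k.
Proof.
move=> kN; rewrite {2}/Defs.wrap /= eqSS; case: eqP => [->|/eqP kn] //=.
by rewrite wrap_id.
Qed.

Lemma sum_wrap (R : zmodType) (N : nat) (F : nat -> R) : (0 < N)%N ->
  \sum_(1 <= k < N.+1) F (Defs.wrap N k.+1) = \sum_(1 <= k < N.+1) F k.
Proof.
move=> N0; rewrite big_nat_recr//= {2}/Defs.wrap /= eqxx addrC.
rewrite [RHS]big_nat_recl//; congr (_ + _).
rewrite !big_nat; apply: eq_bigr => k kN.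
by rewrite wrap_id//; lia.
Qed.

(** For [xi < 0] the endpoint [xi] belongs to the range of [psi_dom]; for [xi >= 0] one has
    [expR xi >= 1]. *)
Lemma psi_dom_gt0 (R : realType) (xi nu : R) : -1 < nu -> psi_dom xi nu ->
  0 < nu + expR xi.
Proof.
move=> nu1 d; have [xi0|xi0] := ltP xi 0.
  by rewrite addrC; apply: d; rewrite lexx xi0 orbT.
by have := expR_ge1Dx xi; lra.
Qed.

Lemma periodic_dom_gtN1 (R : realType) (N : nat) (y z : nat -> R) (nu : R) :
  (0 < N)%N -> Lambda_dom Periodic N y z nu -> -1 < nu.
Proof.
move=> N0 d; rewrite ltNge; apply/negP => nu1.
(* Otherwise [y] would strictly increase around the cycle. *)
have incr k : (1 <= k <= N)%N -> y k < y (Defs.wrap N k.+1).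
  move=> kN; have [yz dk] := d k kN.
  (* A negative exponent would make the argument of the logarithm negative; hence
     [y k < z k <= y (wrap N k.+1)]. *)
  have [lt0|] := ltP (y (Defs.wrap N k.+1) - z k) 0; last lra.
  have := dk (y (Defs.wrap N k.+1) - z k); rewrite lexx lt0 orbT => /(_ isT).
  by rewrite -expR_lt1 in lt0; lra.
have le1 k : (1 <= k <= N)%N -> y 1%N <= y k.
  elim: k => // k IH kN; case: k IH kN => // k IH kN.
  have kN' : (1 <= k.+1 <= N)%N by lia.
  have := incr _ kN'; rewrite wrap_id; last by lia.
  by have := IH kN'; lra.
have := incr N; have := le1 N; rewrite /Defs.wrap /= eqxx.
by rewrite N0 leqnn => /(_ isT) h1 /(_ isT); lra.
Qed.

Lemma periodic_dom_gt0 (R : realType) (N : nat) (y z : nat -> R) (nu : R) k :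
  Lambda_dom Periodic N y z nu -> (1 <= k <= N)%N ->
  0 < z k - y k /\ 0 < nu + expR (y (Defs.wrap N k.+1) - z k).
Proof.
move=> d kN; have [yz dk] := d k kN; split=> //.
by apply: psi_dom_gt0 => //; apply: periodic_dom_gtN1 d; lia.
Qed.

(** * Closure in the periodic and open-end cases *)

Definition node_var (c : bc) (N : nat) {R : realType} (lam : R)
    (x xt xht : nat -> R) (k : nat) : R :=
  (lam + ex c N x k.+1 xt k) / (expR (xht k - xt k) - 1).

(** Cross-multiplied (E1): the [g] of the bond leaving site [k] is the [g'] of the bond entering
    it. *)
Lemma node_varE (R : realType) (c : bc) (N : nat) (lam mu : R)
    (x xt xh xht : nat -> R) (k : nat) :
  0 < xt k - x k -> 0 < xht k - xt k -> corner_eqs c N lam mu x xt xh xht k ->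
  node_var c N lam x xt xht k =
  (mu + ex c N xt k xht k.-1) / (expR (xt k - x k) - 1).
Proof.
move=> a0 c0 [_ e _ _].
have A0 : expR (xt k - x k) - 1 != 0 by rewrite gt_eqF// subr_gt0 expR_gt1.
have C0 : expR (xht k - xt k) - 1 != 0 by rewrite gt_eqF// subr_gt0 expR_gt1.
by apply/eqP; rewrite eqr_div// mulrC e mulrC.
Qed.

Lemma closure_periodic (R : realType) (N : nat) (lam mu : R)
    (x xt xh xht : nat -> R) : (2 <= N)%N ->
  Lambda_dom Periodic N x xt lam -> Lambda_dom Periodic N xt xht mu ->
  Lambda_dom Periodic N x xh mu -> Lambda_dom Periodic N xh xht lam ->
  (forall k : nat, (1 <= k <= N)%N -> corner_eqs Periodic N lam mu x xt xh xht k) ->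
  Lambda Periodic N x xt lam + Lambda Periodic N xt xht mu
  - Lambda Periodic N x xh mu - Lambda Periodic N xh xht lam = 0.
Proof.
move=> N2 d1 d2 d3 d4 E; have N0 : (0 < N)%N by lia.
have l1 := periodic_dom_gtN1 _ _ _ _ _ N0 d1.
have m1 := periodic_dom_gtN1 _ _ _ _ _ N0 d2.
pose P k := potential lam mu (xt k) (xh k) (node_var Periodic N lam x xt xht k).
have bond k : (1 <= k <= N)%N -> let s := Defs.wrap N k.+1 in
    psi (xt s - x s) (-1) + psi (xht k - xt k) (-1)
    - psi (xh s - x s) (-1) - psi (xht k - xh k) (-1)
    - psi (x s - xt k) lam - psi (xt s - xht k) mu
    + psi (x s - xh k) mu + psi (xh s - xht k) lam = P k - P s.
  move=> kN s; have sN : (1 <= s <= N)%N by exact: wrap_range.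
  have [a0 _] := periodic_dom_gt0 _ _ _ _ _ _ d1 sN.
  have [b0 _] := periodic_dom_gt0 _ _ _ _ _ _ d3 sN.
  have [c0' _] := periodic_dom_gt0 _ _ _ _ _ _ d2 sN.
  have [_ al0] := periodic_dom_gt0 _ _ _ _ _ _ d1 kN.
  have [c0 ga0] := periodic_dom_gt0 _ _ _ _ _ _ d2 kN.
  have [_ be0] := periodic_dom_gt0 _ _ _ _ _ _ d3 kN.
  have [dd0 de0] := periodic_dom_gt0 _ _ _ _ _ _ d4 kN.
  (* A bond uses (E) at its right end and (E12) at its left end. *)
  have [e1 _ _ _] := E s sN; have [_ _ _ e2] := E k kN.
  rewrite /ex (wrap_id _ _ sN) (wrap_pred_succ _ _ kN) in e1.
  rewrite /ex -/s (wrap_id _ _ kN) in e2.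
  rewrite (bond_closure _ _ _ _ _ _ _ _ _ l1 m1 a0 b0 c0 dd0 al0 be0 ga0 de0 e1 e2).
  have nk : node_var Periodic N lam x xt xht k =
      (lam + expR (x s - xt k)) / (expR (xht k - xt k) - 1).
    by rewrite /node_var /ex (wrap_id _ _ kN).
  have ns : node_var Periodic N lam x xt xht s =
      (mu + expR (xt s - xht k)) / (expR (xt s - x s) - 1).
    rewrite (node_varE _ _ _ _ _ _ _ _ _ _ a0 c0' (E s sN)).
    by rewrite /ex (wrap_id _ _ sN) (wrap_pred_succ _ _ kN).
  by rewrite /P nk ns.
clearbody P; rewrite /Lambda.
(* The bond at [k] carries these terms at the successor of [k], so their sums are shifted
   cyclically. *)
rewrite -(sum_wrap _ _ (fun k => psi (xt k - x k) (-1)))//.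
rewrite -(sum_wrap _ _ (fun k => psi (xh k - x k) (-1)))//.
transitivity (\sum_(1 <= k < N.+1) (P k - P (Defs.wrap N k.+1))); last first.
  by rewrite sumrB (sum_wrap _ _ P N0) subrr.
under [RHS]eq_big_nat => k kN do rewrite -bond//.
rewrite !(sumrB, big_split)/=; ring.
Qed.

Lemma closure_open (R : realType) (N : nat) (lam mu : R)
    (x xt xh xht : nat -> R) : (2 <= N)%N ->
  Lambda_dom OpenEnd N x xt lam -> Lambda_dom OpenEnd N xt xht mu ->
  Lambda_dom OpenEnd N x xh mu -> Lambda_dom OpenEnd N xh xht lam ->
  (forall k : nat, (1 <= k <= N)%N -> corner_eqs OpenEnd N lam mu x xt xh xht k) ->
  Lambda OpenEnd N x xt lam + Lambda OpenEnd N xt xht mu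
  - Lambda OpenEnd N x xh mu - Lambda OpenEnd N xh xht lam = 0.
Proof.
move=> N2 [l0 [A _]] [m0 [C _]] [_ [B _]] [_ [D _]] E.
pose g := node_var OpenEnd N lam x xt xht.
have exin (f f' : nat -> R) i j : (1 <= i <= N)%N -> (1 <= j <= N)%N ->
    ex OpenEnd N f i f' j = expR (f i - f' j) by move=> iN jN; rewrite /ex iN jN.
have ex0 (f f' : nat -> R) i : ex OpenEnd N f i f' 0 = 0 by rewrite /ex andbF.
have exS (f f' : nat -> R) j : ex OpenEnd N f N.+1 f' j = 0.
  by rewrite /ex ltnn.
have gt0e (nu u : R) : 0 < nu -> 0 < nu + expR u.
  by move=> nu0; have := expR_gt0 u; lra.
have g0 k : (1 <= k <= N)%N -> 0 < g k.
  move=> kN; rewrite /g /node_var divr_gt0 ?subr_gt0 ?expR_gt1 ?C//.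
  by rewrite /ex; case: ifP => _; [exact: gt0e|rewrite addr0].
have bond k : (1 <= k < N)%N ->
    psi (xt k.+1 - x k.+1) (-1) + psi (xht k - xt k) (-1)
    - psi (xh k.+1 - x k.+1) (-1) - psi (xht k - xh k) (-1)
    - psi (x k.+1 - xt k) lam - psi (xt k.+1 - xht k) mu
    + psi (x k.+1 - xh k) mu + psi (xh k.+1 - xht k) lam
    = node lam mu (g k) - node lam mu (g k.+1).
  move=> kN; have kN' : (1 <= k <= N)%N by lia.
  have sN : (1 <= k.+1 <= N)%N by lia.
  have [e1 _ _ _] := E _ sN; have [_ _ _ e2] := E _ kN'.
  rewrite !exin//= in e1 e2.
  (* Positive parameters exclude the degenerate branch of [potential]. *)
  have nz j : (1 <= j <= N)%N -> (lam + g j == 0) = false.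
    by move=> jN; rewrite gt_eqF// addr_gt0// g0.
  have gk : g k = (lam + expR (x k.+1 - xt k)) / (expR (xht k - xt k) - 1).
    by rewrite /g /node_var exin.
  have gs : g k.+1 = (mu + expR (xt k.+1 - xht k)) / (expR (xt k.+1 - x k.+1) - 1).
    by rewrite /g (node_varE _ _ _ _ _ _ _ _ _ _ (A _ sN) (C _ sN) (E _ sN)) exin.
  have l1 : -1 < lam by apply: lt_trans l0.
  have m1 : -1 < mu by apply: lt_trans m0.
  rewrite (bond_closure _ _ _ _ _ _ _ _ _ l1 m1 (A _ sN) (B _ sN) (C _ kN') (D _ kN')
    (gt0e _ _ l0) (gt0e _ _ m0) (gt0e _ _ m0) (gt0e _ _ l0) e1 e2).
  by rewrite -gk -gs /potential !nz.
have N1 : (1 <= N <= N)%N by lia.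
have I1 : (1 <= 1 <= N)%N by lia.
have [e1 _ _ _] := E _ I1; have [_ _ _ eN] := E _ N1.
rewrite !ex0 !addr0 in e1; rewrite !exS !addr0 in eN.
have nzE (u : R) : 0 < u -> expR u - 1 != 0.
  by move=> u0; rewrite gt_eqF// subr_gt0 expR_gt1.
have g1 : g 1%N = mu / (expR (xt 1%N - x 1%N) - 1).
  by rewrite /g (node_varE _ _ _ _ _ _ _ _ _ _ (A _ I1) (C _ I1) (E _ I1)) ex0 addr0.
have gN : g N = lam / (expR (xht N - xt N) - 1) by rewrite /g /node_var exS addr0.
(* (E) at 1 and (E12) at [N] are star relations with [q = 0]. They turn the four terms contained in
   no bond, two at each end, into values of [edge0], whose logarithmic parts match those of
   [Lambda]. *)
have := edge0_diff _ _ _ _ _ l0 m0 (g0 _ N1) (g0 _ I1).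
rewrite (edge0E _ lam (g N) (xht N - xt N)); last 2 first.
- by rewrite gt_eqF// g0.
- by rewrite gN mulrC divfK// nzE// C.
rewrite (edge0E _ mu (g N) (xht N - xh N)); last 2 first.
- by rewrite gt_eqF// g0.
- by rewrite gN mulrA eN mulrC mulKf// nzE// C.
rewrite (edge0E _ mu (g 1%N) (xt 1%N - x 1%N)); last 2 first.
- by rewrite gt_eqF// g0.
- by rewrite g1 mulrC divfK// nzE// A.
rewrite (edge0E _ lam (g 1%N) (xh 1%N - x 1%N)); last 2 first.
- by rewrite gt_eqF// g0.
- apply: (mulfI (nzE _ (A _ I1))); rewrite e1 g1.
  by rewrite mulrCA; congr (_ * _); rewrite mulrC divfK// nzE// A.
have tel : \sum_(1 <= k < N) (node lam mu (g k) - node lam mu (g k.+1))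
    = node lam mu (g 1%N) - node lam mu (g N).
  by rewrite -[LHS]opprK -sumrN; under eq_bigr do rewrite opprB;
     rewrite telescope_sumr ?opprB//; lia.
move: tel; under eq_big_nat => k kN do rewrite -bond//.
have N0 : (0 < N)%N by lia.
rewrite !(sumrB, big_split)/= /Lambda.
(* The bonds cover indices 2 to [N] of these two sums and 1 to [N - 1] of the next two; the missing
   terms are the boundary ones. *)
rewrite (big_nat_recl _ 1 (fun k => psi (xt k - x k) (-1)))//.
rewrite (big_nat_recl _ 1 (fun k => psi (xh k - x k) (-1)))//.
rewrite (big_nat_recr _ 1 (fun k => psi (xht k - xt k) (-1)))//=.
rewrite (big_nat_recr _ 1 (fun k => psi (xht k - xh k) (-1)))//=.
move=> tel bd.
move: tel bd; move: (@psi R) (node lam mu) => f h.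
clear; lra.
Qed.

Theorem theorem8 (R : realType) (c : bc) (N : nat) (lam mu : R)
    (x xt xh xht : nat -> R) :
  (2 <= N)%N ->
  Lambda_dom c N x xt lam -> Lambda_dom c N xt xht mu ->
  Lambda_dom c N x xh mu -> Lambda_dom c N xh xht lam ->
  (forall k : nat, (1 <= k <= N)%N -> corner_eqs c N lam mu x xt xh xht k) ->
  Lambda c N x xt lam + Lambda c N xt xht mu
  - Lambda c N x xh mu - Lambda c N xh xht lam = 0.
Proof.
by case: c; [exact: closure_periodic|exact: closure_open].
Qed.
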